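(* JT-hardness coincides with BLR-hardness: for every set $B\subseteq\mathbb{N}$, $\emptyset'\le_{JT}B$ if and only if $\emptyset'\le_{BLR}B$.
   Context: Let $\{\Phi_n^X\}_{n\in\mathbb{N}}$ be a standard list of all functions partial computable in the oracle $X$, let $W_n^X$ be the domain of $\Phi_n^X$, and let $J^X(n)=\Phi_n^X(n)$. $X\le_{JT}Y$ ($X$ is jump traceable by $Y$) means there are computable functions $f,g$ such that for all $n$, if $J^X(n)\downarrow$ then $J^X(n)\in W_{f(n)}^Y$, and for all $n$, $W_{f(n)}^Y$ is finite of cardinality at most $g(n)$. $B$ is JT-hard if $\emptyset'\le_{JT}B$. For a set $A$, $\mathrm{BLR}(A)$ is the class of functions $f:\omega\to\omega$ for which there are an $A$-computable function $\tilde f:\omega\times\omega\to\omega$ and a computable function $g:\omega\to\omega$ (computable without oracle) such that for all $n$, $f(n)=\lim_s\tilde f(n,s)$ and the set $\{s:\tilde f(n,s)\ne\tilde f(n,s+1)\}$ has cardinality less than $g(n)$. $X\le_{BLR}Y$ means $\mathrm{BLR}(X)\subseteq\mathrm{BLR}(Y)$. $B$ is BLR-hard if $\emptyset'\le_{BLR}B$. *)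

(* Defs.v *)
From Stdlib Require Cantor.
From mathcomp Require Import all_boot.
From mathcomp Require Import boolp classical_sets functions cardinality filter.

Set Implicit Arguments.
Unset Strict Implicit.
Unset Printing Implicit Defensive.

Local Open Scope classical_set_scope.
Local Open Scope card_scope.
Local Open Scope nat_scope.

(* Cantor's bijection from nat * nat to nat. *)
Definition npair (x y : nat) : nat := Cantor.to_nat (x, y).

Notation "⟨ x , y ⟩" := (npair x y) (at level 0, format "⟨ x ,  y ⟩").

(* Kleene's indexing of the functions partial recursive in the oracle X:
   [Phi X e x y] means that Phi_e^X(x) converges with value y.  An index is a
   pair of a tag and the parameters of a scheme.  Functions are unary, those of
   several arguments being coded by pairing: the schemes are 0, successor, the
   two projections of a pair, the characteristic function of X, pairing,
   composition, primitive recursion and minimization.  An index of none of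
   these forms denotes the nowhere defined function.  Indices do not depend on
   X, so the list is uniform in the oracle. *)
Inductive Phi (X : set nat) : nat -> nat -> nat -> Prop :=
| Phi_zero x : Phi X ⟨0, 0⟩ x 0
| Phi_succ x : Phi X ⟨1, 0⟩ x x.+1
| Phi_left x y : Phi X ⟨2, 0⟩ ⟨x, y⟩ x
| Phi_right x y : Phi X ⟨3, 0⟩ ⟨x, y⟩ y
| Phi_oracle_in x : X x -> Phi X ⟨4, 0⟩ x 1
| Phi_oracle_out x : ~ X x -> Phi X ⟨4, 0⟩ x 0
| Phi_pair a b x y z :
    Phi X a x y -> Phi X b x z -> Phi X ⟨5, ⟨a, b⟩⟩ x ⟨y, z⟩
| Phi_comp a b x y z :
    Phi X b x y -> Phi X a y z -> Phi X ⟨6, ⟨a, b⟩⟩ x z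
| Phi_prec0 a b x y :
    Phi X a x y -> Phi X ⟨7, ⟨a, b⟩⟩ ⟨x, 0⟩ y
| Phi_precS a b x n y z :
    Phi X ⟨7, ⟨a, b⟩⟩ ⟨x, n⟩ y -> Phi X b ⟨x, ⟨n, y⟩⟩ z ->
    Phi X ⟨7, ⟨a, b⟩⟩ ⟨x, n.+1⟩ z
(* y is least with Phi_a^X(x, y) = 0; the values v m + 1 witness that the
   earlier computations converge to something nonzero *)
| Phi_mu a x y (v : nat -> nat) :
    (forall m, m < y -> Phi X a ⟨x, m⟩ (v m).+1) ->
    Phi X a ⟨x, y⟩ 0 -> Phi X ⟨8, a⟩ x y.

Definition W (X : set nat) (e : nat) : set nat :=
  [set x | exists y, Phi X e x y].

Definition J (X : set nat) (n y : nat) : Prop := Phi X n n y.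

Definition jump (X : set nat) : set nat := [set n | exists y, J X n y].

Definition computable_in (X : set nat) (f : nat -> nat) : Prop :=
  exists e, forall x, Phi X e x (f x).

Definition computable2_in (X : set nat) (f : nat -> nat -> nat) : Prop :=
  exists e, forall x y, Phi X e ⟨x, y⟩ (f x y).

Definition computable (f : nat -> nat) : Prop := computable_in set0 f.

Definition JT_le (X Y : set nat) : Prop :=
  exists f g : nat -> nat,
    [/\ computable f, computable g,
        forall n y, J X n y -> W Y (f n) y
      & forall n, exists2 k, k <= g n & W Y (f n) #= `I_k].

Definition JT_hard (B : set nat) : Prop := JT_le (jump set0) B.

Definition BLR (A : set nat) : set (nat -> nat) :=
  [set f | exists (ft : nat -> nat -> nat) (g : nat -> nat),
    [/\ computable2_in A ft, computable g,
        forall n, \forall s \near \oo, ft n s = f n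
      & forall n, exists2 k, k < g n &
          [set s | ft n s <> ft n s.+1] #= `I_k]].

Definition BLR_le (X Y : set nat) : Prop := BLR X `<=` BLR Y.

Definition BLR_hard (B : set nat) : Prop := BLR_le (jump set0) B.

(* Main.v *)
(* Left to right: by the limit lemma a 0'-computable approximation F(n, s) is the
   limit in t of a computable c(n, s, t).  For each n and i, 0' can find a pair
   (s, t) such that F(n, .) changes i times up to s and c(n, s', .) is constant
   from t on for all s' <= s, and by hypothesis the result of this search is
   traced by B, with a computable bound.  Whether a pair is right can be refuted
   computably, so each traced pair changes status at most twice (it shows up, it
   is refuted).  Hence B approximates lim_s F(n, s), with a computable bound on
   the number of changes, by the value that the unrefuted pairs suggest for the
   largest possible i.
   Right to left: f(n) = J^{0'}(n) + 1, or 0 if this diverges, is in BLR(0') since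
   its approximation by stages changes at most once.  The values of an
   approximation of f that witnesses f in BLR(B) are a trace for J^{0'}. *)
Require Import Defs.
From Stdlib Require Cantor.
From mathcomp Require Import all_boot zify.
From mathcomp Require Import boolp classical_sets functions cardinality filter.

Set Implicit Arguments.
Unset Strict Implicit.
Unset Printing Implicit Defensive.

Local Open Scope nat_scope.


(** * Decoding of pairs *)

Definition lft (z : nat) : nat := (Cantor.of_nat z).1.
Definition rgt (z : nat) : nat := (Cantor.of_nat z).2.

Lemma lft_pair x y : lft ⟨x, y⟩ = x.
Proof. by rewrite /lft /npair Cantor.cancel_of_to. Qed.

Lemma rgt_pair x y : rgt ⟨x, y⟩ = y.
Proof. by rewrite /rgt /npair Cantor.cancel_of_to. Qed.

Lemma pair_eta z : ⟨lft z, rgt z⟩ = z.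
Proof.
by rewrite /npair /lft /rgt -surjective_pairing Cantor.cancel_to_of.
Qed.

Opaque npair lft rgt.
Definition pairE := (lft_pair, rgt_pair).

(** * Closure properties of computable functions *)

Section Closure.
Variable X : set nat.
Implicit Types F G H N : nat -> nat.

Lemma computable_ext F G : F =1 G -> computable_in X F -> computable_in X G.
Proof. by move=> FG [e eP]; exists e => x; rewrite -FG. Qed.

Lemma computable_comp F G :
  computable_in X F -> computable_in X G -> computable_in X (fun z => F (G z)).
Proof.
by move=> [a aP] [b bP]; exists ⟨6, ⟨a, b⟩⟩ => x; apply: Phi_comp (bP x) (aP _).
Qed.

Lemma computable_pair F G : computable_in X F -> computable_in X G ->
  computable_in X (fun z => ⟨F z, G z⟩).
Proof.
by move=> [a aP] [b bP]; exists ⟨5, ⟨a, b⟩⟩ => x; apply: Phi_pair.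
Qed.

Lemma computable_lft F : computable_in X F -> computable_in X (fun z => lft (F z)).
Proof.
apply: (@computable_comp lft); exists ⟨2, 0⟩ => x.
by rewrite -{1}(pair_eta x); apply: Phi_left.
Qed.

Lemma computable_rgt F : computable_in X F -> computable_in X (fun z => rgt (F z)).
Proof.
apply: (@computable_comp rgt); exists ⟨3, 0⟩ => x.
by rewrite -{1}(pair_eta x); apply: Phi_right.
Qed.

Lemma computable_id : computable_in X id.
Proof.
exists ⟨5, ⟨⟨2, 0⟩, ⟨3, 0⟩⟩⟩ => x; rewrite -(pair_eta x).
by apply: Phi_pair; [apply: Phi_left|apply: Phi_right].
Qed.

Lemma computable_succ F : computable_in X F -> computable_in X (fun z => (F z).+1).
Proof. by apply: (@computable_comp succn); exists ⟨1, 0⟩; apply: Phi_succ. Qed.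

Lemma computable_const k : computable_in X (fun=> k).
Proof.
elim: k => [|k IH]; first by exists ⟨0, 0⟩; apply: Phi_zero.
exact: computable_succ.
Qed.

Lemma computable_app2 (f : nat -> nat -> nat) F G : computable2_in X f ->
  computable_in X F -> computable_in X G -> computable_in X (fun z => f (F z) (G z)).
Proof.
move=> [e eP] Fc Gc; have [d dP] := computable_pair Fc Gc.
by exists ⟨6, ⟨e, d⟩⟩ => x; apply: Phi_comp (dP x) (eP _ _).
Qed.

Definition primrec (a : nat) (f : nat -> nat -> nat) (n : nat) : nat :=
  nat_rec (fun=> nat) a f n.

Lemma computable_primrec F (G : nat -> nat -> nat -> nat) N :
  computable_in X F ->
  computable_in X (fun w => G (lft w) (lft (rgt w)) (rgt (rgt w))) ->
  computable_in X N -> computable_in X (fun z => primrec (F z) (G z) (N z)).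
Proof.
move=> [a aP] [b bP] Nc.
have [d dP] := computable_pair computable_id Nc.
exists ⟨6, ⟨⟨7, ⟨a, b⟩⟩, d⟩⟩ => x; apply: Phi_comp (dP x) _.
elim: (N x) => [|n IH] /=; first exact: Phi_prec0.
apply: Phi_precS IH _.
by have := bP ⟨x, ⟨n, primrec (F x) (G x) n⟩⟩; rewrite !pairE.
Qed.

(** A case distinction is a primitive recursion of length [b z], which is 0 or 1: it starts from
    [G z], and one step replaces this by [F z]. *)
Lemma computable_if (b : nat -> bool) F G :
  computable_in X (fun z => b z : nat) -> computable_in X F -> computable_in X G ->
  computable_in X (fun z => if b z then F z else G z).
Proof.
move=> bc Fc Gc.
have Fc' : computable_in X (fun w => F (lft w)).
  exact: computable_comp Fc (computable_lft computable_id).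
apply: (computable_ext _ (@computable_primrec _ (fun z _ _ => F z) _ Gc Fc' bc)).
by move=> z; case: (b z).
Qed.

Lemma computable_andb (b c : nat -> bool) :
  computable_in X (fun z => b z : nat) -> computable_in X (fun z => c z : nat) ->
  computable_in X (fun z => b z && c z : nat).
Proof.
move=> bc cc; apply: (computable_ext _ (computable_if bc cc (computable_const 0))).
by move=> z; case: (b z).
Qed.

Lemma computable_orb (b c : nat -> bool) :
  computable_in X (fun z => b z : nat) -> computable_in X (fun z => c z : nat) ->
  computable_in X (fun z => b z || c z : nat).
Proof.
move=> bc cc; apply: (computable_ext _ (computable_if bc (computable_const 1) cc)).
by move=> z; case: (b z).
Qed.

Lemma computable_negb (b : nat -> bool) :
  computable_in X (fun z => b z : nat) -> computable_in X (fun z => ~~ b z : nat).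
Proof.
move=> bc.
apply: (computable_ext _ (computable_if bc (computable_const 0) (computable_const 1))).
by move=> z; case: (b z).
Qed.

Lemma computable_pred F : computable_in X F -> computable_in X (fun z => (F z).-1).
Proof.
move=> Fc; apply: (computable_ext _ (@computable_primrec _ (fun _ n _ => n) _
  (computable_const 0) _ Fc)); first by move=> z; case: (F z).
exact: computable_lft (computable_rgt computable_id).
Qed.

Lemma computable_add F G : computable_in X F -> computable_in X G ->
  computable_in X (fun z => F z + G z).
Proof.
move=> Fc Gc; apply: (computable_ext _ (@computable_primrec _ (fun _ _ r => r.+1) _
  Fc _ Gc)); last exact: computable_succ (computable_rgt (computable_rgt computable_id)).
by move=> z; elim: (G z) => [|n /= ->]; rewrite ?addn0 ?addnS.
Qed.

Lemma computable_sub F G : computable_in X F -> computable_in X G ->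
  computable_in X (fun z => F z - G z).
Proof.
move=> Fc Gc; apply: (computable_ext _ (@computable_primrec _ (fun _ _ r => r.-1) _
  Fc _ Gc)); last exact: computable_pred (computable_rgt (computable_rgt computable_id)).
by move=> z; elim: (G z) => [|n /= ->]; rewrite ?subn0 ?subnS.
Qed.

Lemma computable_leq F G : computable_in X F -> computable_in X G ->
  computable_in X (fun z => F z <= G z : nat).
Proof.
move=> Fc Gc; apply: (computable_ext _
  (computable_sub (computable_const 1) (computable_sub Fc Gc))).
by move=> z; rewrite /leq; case: (F z - G z).
Qed.

Lemma computable_eq F G : computable_in X F -> computable_in X G ->
  computable_in X (fun z => F z == G z : nat).
Proof.
move=> Fc Gc; apply: (computable_ext _
  (computable_andb (computable_leq Fc Gc) (computable_leq Gc Fc))).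
by move=> z; rewrite -eqn_leq.
Qed.

Lemma computable_sum (F : nat -> nat -> nat) N :
  computable_in X (fun w => F (lft w) (rgt w)) -> computable_in X N ->
  computable_in X (fun z => \sum_(0 <= i < N z) F z i).
Proof.
move=> Fc Nc; apply: (computable_ext _ (@computable_primrec _ (fun z i r => r + F z i) _
  (computable_const 0) _ Nc)).
  by move=> z; elim: (N z) => [|n /= ->]; [rewrite big_geq|rewrite big_nat_recr].
apply: computable_add; first exact: computable_rgt (computable_rgt computable_id).
apply: (@computable_ext (fun w => F (lft ⟨lft w, lft (rgt w)⟩) (rgt ⟨lft w, lft (rgt w)⟩))).
  by move=> w; rewrite !pairE.
apply: (computable_comp Fc); apply: computable_pair; first exact: computable_lft computable_id.
exact: computable_lft (computable_rgt computable_id).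
Qed.

Lemma computable_all (P : nat -> nat -> bool) N :
  computable_in X (fun w => P (lft w) (rgt w) : nat) -> computable_in X N ->
  computable_in X (fun z => all (P z) (iota 0 (N z)) : nat).
Proof.
move=> Pc Nc.
apply: (computable_ext _ (computable_eq (computable_sum
  (F := fun z i => ~~ P z i) (computable_negb Pc) Nc) (computable_const 0))).
move=> z; congr nat_of_bool; rewrite /index_iota subn0.
by elim: (iota _ _) => [|i s IH] /=; rewrite ?big_nil ?big_cons // addn_eq0 IH eqb0 negbK.
Qed.

(* The value of [V] at the largest [i < n] where it is nonzero, or 0. *)
Definition lastval (V : nat -> nat) (n : nat) : nat :=
  primrec 0 (fun i r => if V i == 0 then r else V i) n.

Lemma computable_lastval (F : nat -> nat -> nat) N :
  computable_in X (fun w => F (lft w) (rgt w)) -> computable_in X N ->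
  computable_in X (fun z => lastval (F z) (N z)).
Proof.
move=> Fc Nc.
have Fc' : computable_in X (fun w => F (lft w) (lft (rgt w))).
  apply: (@computable_ext (fun w => F (lft ⟨lft w, lft (rgt w)⟩) (rgt ⟨lft w, lft (rgt w)⟩))).
    by move=> w; rewrite !pairE.
  apply: (computable_comp Fc); apply: computable_pair; first exact: computable_lft computable_id.
  exact: computable_lft (computable_rgt computable_id).
apply: (@computable_primrec _ (fun z i r => if F z i == 0 then r else F z i)) => //.
  exact: computable_const.
apply: computable_if => //; first exact: computable_eq Fc' (computable_const 0).
exact: computable_rgt (computable_rgt computable_id).
Qed.

Lemma computable_iter (f : nat -> nat -> nat) F N :
  computable_in X (fun w => f (lft w) (rgt w)) -> computable_in X F ->
  computable_in X N -> computable_in X (fun z => iter (N z) (f z) (F z)).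
Proof.
move=> fc Fc Nc; apply: (computable_ext _ (@computable_primrec _ (fun z _ r => f z r) _
  Fc _ Nc)); first by move=> z; elim: (N z) => //= n ->.
apply: (@computable_ext (fun w => f (lft ⟨lft w, rgt (rgt w)⟩) (rgt ⟨lft w, rgt (rgt w)⟩))).
  by move=> w; rewrite !pairE.
apply: (computable_comp fc); apply: computable_pair; first exact: computable_lft computable_id.
exact: computable_rgt (computable_rgt computable_id).
Qed.

End Closure.

(** One rule per closure lemma, chosen by the shape of the function; goals that fit no rule are left
    open. *)
Ltac computability :=
  repeat (cbv beta; match goal with
  | |- computable_in _ (fun z => z) => apply: computable_id
  | |- computable_in ?X lft => apply: (computable_lft (computable_id X))
  | |- computable_in ?X rgt => apply: (computable_rgt (computable_id X))
  | H : computable_in ?X ?f |- computable_in ?X ?f => exact: H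
  | |- computable_in _ (fun _ => ?k) => apply: (computable_const _ k)
  | |- computable_in _ (fun z => npair (@?F z) (@?G z)) => apply: (@computable_pair _ F G)
  | |- computable_in _ (fun z => lft (@?F z)) => apply: (@computable_lft _ F)
  | |- computable_in _ (fun z => rgt (@?F z)) => apply: (@computable_rgt _ F)
  | |- computable_in _ (fun z => nat_of_bool (@?b z && @?c z)) => apply: (@computable_andb _ b c)
  | |- computable_in _ (fun z => nat_of_bool (@?b z || @?c z)) => apply: (@computable_orb _ b c)
  | |- computable_in _ (fun z => nat_of_bool (~~ @?b z)) => apply: (@computable_negb _ b)
  | |- computable_in _ (fun z => nat_of_bool (@?F z == @?G z)) => apply: (@computable_eq _ F G)
  | |- computable_in _ (fun z => nat_of_bool (@?F z <= @?G z)) => apply: (@computable_leq _ F G)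
  | |- computable_in _ (fun z => if _ then _ else _) => apply: computable_if
  | |- computable_in _ (fun z => (@?F z).+1) => apply: (@computable_succ _ F)
  | |- computable_in _ (fun z => (@?F z).-1) => apply: (@computable_pred _ F)
  | |- computable_in _ (fun z => @?F z + @?G z) => apply: (@computable_add _ F G)
  | |- computable_in _ (fun z => nat_of_bool (all (@?P z) (iota 0 (@?N z)))) =>
      apply: (@computable_all _ P N)
  | |- computable_in _ (fun z => lastval (@?V z) (@?N z)) =>
      apply: (@computable_lastval _ V N)
  | H : computable_in ?X ?f |- computable_in ?X (fun z => ?f (@?F z)) => apply: (@computable_comp _ f F H)
  | H : computable2_in ?X ?f |- computable_in ?X (fun z => ?f (@?F z) (@?G z)) =>
      apply: (@computable_app2 _ f F G H)
  end).

Lemma computable2P X (f : nat -> nat -> nat) :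
  computable2_in X f <-> computable_in X (fun z => f (lft z) (rgt z)).
Proof.
split=> [fc|[e eP]]; first by computability.
by exists e => x y; have := eP ⟨x, y⟩; rewrite !pairE.
Qed.

(** * An abstract machine for oracle computations *)

(* The configurations of the machine are coded by numbers: [eval_conf e x K] is
   about to compute the function of index [e] at [x], and [ret_conf y K] has
   just obtained the value [y]; the stack [K] records what remains to be done,
   0 being the empty stack. *)
Definition eval_conf (e x K : nat) : nat := ⟨0, ⟨⟨e, x⟩, K⟩⟩.
Definition ret_conf (y K : nat) : nat := ⟨1, ⟨y, K⟩⟩.
(** The successor keeps a nonempty stack distinct from 0. *)
Definition push (fr K : nat) : nat := ⟨fr, K⟩.+1.

(** An index of none of the valid forms leaves the configuration unchanged, so the machine loops, in
    accordance with the nowhere defined function. *)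
Definition eval_step (o : nat -> nat) (e x K : nat) : nat :=
  if (lft e < 5) && (0 < rgt e) then eval_conf e x K
  else if lft e == 0 then ret_conf 0 K
  else if lft e == 1 then ret_conf x.+1 K
  else if lft e == 2 then ret_conf (lft x) K
  else if lft e == 3 then ret_conf (rgt x) K
  else if lft e == 4 then ret_conf (o x) K
  else if lft e == 5 then
    eval_conf (lft (rgt e)) x (push ⟨0, ⟨rgt (rgt e), x⟩⟩ K)
  else if lft e == 6 then eval_conf (rgt (rgt e)) x (push ⟨2, lft (rgt e)⟩ K)
  else if lft e == 7 then
    if rgt x == 0 then eval_conf (lft (rgt e)) (lft x) K
    else eval_conf e ⟨lft x, (rgt x).-1⟩
           (push ⟨3, ⟨rgt (rgt e), ⟨lft x, (rgt x).-1⟩⟩⟩ K)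
  else if lft e == 8 then
    eval_conf (rgt e) ⟨x, 0⟩ (push ⟨4, ⟨rgt e, ⟨x, 0⟩⟩⟩ K)
  else eval_conf e x K.

(** The tag of a frame says what awaits the value: 0 and 1 the first and second component of a pair,
    2 the outer function of a composition, 3 the step function of a primitive recursion, 4 the test
    for zero in a minimization. *)
Definition ret_step (y fr K : nat) : nat :=
  if lft fr == 0 then
    eval_conf (lft (rgt fr)) (rgt (rgt fr)) (push ⟨1, y⟩ K)
  else if lft fr == 1 then ret_conf ⟨rgt fr, y⟩ K
  else if lft fr == 2 then eval_conf (rgt fr) y K
  else if lft fr == 3 then
    eval_conf (lft (rgt fr))
      ⟨lft (rgt (rgt fr)), ⟨rgt (rgt (rgt fr)), y⟩⟩ K
  else if y == 0 then ret_conf (rgt (rgt (rgt fr))) K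
  else eval_conf (lft (rgt fr)) ⟨lft (rgt (rgt fr)), (rgt (rgt (rgt fr))).+1⟩
         (push ⟨4, ⟨lft (rgt fr), ⟨lft (rgt (rgt fr)), (rgt (rgt (rgt fr))).+1⟩⟩⟩ K).

(** A value returned to the empty stack is a fixed point, so an output persists once it is there. *)
Definition step (o : nat -> nat) (c : nat) : nat :=
  if lft c == 0 then
    eval_step o (lft (lft (rgt c))) (rgt (lft (rgt c))) (rgt (rgt c))
  else if rgt (rgt c) == 0 then c
  else ret_step (lft (rgt c)) (lft (rgt (rgt c)).-1) (rgt (rgt (rgt c)).-1).

(** A result [y] is reported as [y.+1]; 0 means that the machine has not halted. *)
Definition output (c : nat) : nat :=
  if (lft c == 1) && (rgt (rgt c) == 0) then (lft (rgt c)).+1 else 0.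

Definition run (o : nat -> nat) (e x s : nat) : nat :=
  output (iter s (step o) (eval_conf e x 0)).

(** The oracle [o (P z)] may vary with the input; in the limit lemma it is a stage of an
    approximation of [0']. *)
Lemma computable_run X (o : nat -> nat -> nat) P E Y S : computable2_in X o ->
  computable_in X P -> computable_in X E -> computable_in X Y -> computable_in X S ->
  computable_in X (fun z => run (o (P z)) (E z) (Y z) (S z)).
Proof.
move=> oc Pc Ec Yc Sc.
have ic : computable_in X (fun z =>
    iter (S z) (step (o (P z))) (eval_conf (E z) (Y z) 0)).
  apply: (@computable_iter _ (fun z => step (o (P z)))) => //.
    by rewrite /step /eval_step /ret_step /eval_conf /ret_conf /push; computability.
  by rewrite /eval_conf; computability.
have out : computable_in X output by rewrite /output; computability.
exact: computable_comp out ic.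
Qed.

(** * Soundness and completeness of the machine *)

Definition chi (Y : set nat) (n : nat) : nat := `[< Y n >].

Section Machine.
Variable o : nat -> nat.
Notation stepn n c := (iter n (step o) c).

Lemma step_eval e x K : step o (eval_conf e x K) = eval_step o e x K.
Proof. by rewrite /step /eval_conf !pairE. Qed.

Lemma step_ret_push y fr K : step o (ret_conf y (push fr K)) = ret_step y fr K.
Proof. by rewrite /step /ret_conf /push !pairE. Qed.

Lemma step_ret_empty y : step o (ret_conf y 0) = ret_conf y 0.
Proof. by rewrite /step /ret_conf !pairE. Qed.

Lemma stepn_ret_empty n y : stepn n (ret_conf y 0) = ret_conf y 0.
Proof. by elim: n => //= n ->; rewrite step_ret_empty. Qed.

Lemma output_ret y : output (ret_conf y 0) = y.+1.
Proof. by rewrite /output /ret_conf !pairE. Qed.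

Lemma output_succ c y : output c = y.+1 -> c = ret_conf y 0.
Proof.
rewrite /output; case: ifP => // /andP[/eqP l1 /eqP r0] [<-].
by rewrite -[LHS]pair_eta l1 -[rgt c]pair_eta r0 !pairE.
Qed.

Lemma run_mono e x y s t : s <= t -> run o e x s = y.+1 -> run o e x t = y.+1.
Proof.
move=> /subnK <- /output_succ rs.
by rewrite /run iterD rs stepn_ret_empty output_ret.
Qed.

Lemma eval_conf_neq_ret e x K y L : eval_conf e x K <> ret_conf y L.
Proof. by move=> /(congr1 lft); rewrite /eval_conf /ret_conf !pairE. Qed.

Lemma ret_push_neq_ret_empty z fr K y : ret_conf z (push fr K) <> ret_conf y 0.
Proof.
by move=> /(congr1 (fun c => rgt (rgt c))); rewrite /ret_conf /push !pairE.
Qed.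

Lemma stepn_eval n e x K y : stepn n (eval_conf e x K) = ret_conf y 0 ->
  exists2 m, n = m.+1 & stepn m (eval_step o e x K) = ret_conf y 0.
Proof.
case: n => [/eval_conf_neq_ret//|n]; rewrite iterSr step_eval.
by exists n.
Qed.

Lemma stepn_ret n z fr K y : stepn n (ret_conf z (push fr K)) = ret_conf y 0 ->
  exists2 m, n = m.+1 & stepn m (ret_step z fr K) = ret_conf y 0.
Proof.
case: n => [/ret_push_neq_ret_empty//|n]; rewrite iterSr step_ret_push.
by exists n.
Qed.

Variable Y : set nat.

Section Sound.
Hypothesis oY : o =1 chi Y.

(** Strong induction on the number of steps. The stack is arbitrary and the remaining run strictly
    shorter, so that the induction hypothesis also applies to the evaluations that the stack starts
    later. *)
Lemma stepn_sound n e x K y : stepn n (eval_conf e x K) = ret_conf y 0 ->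
  exists z m, [/\ m < n, Phi Y e x z & stepn m (ret_conf z K) = ret_conf y 0].
Proof.
elim/ltn_ind: n e x K y => n IH e x K y.
move=> /stepn_eval[{}n' n_def]; rewrite /eval_step.
have IH' m e' x' K' z : m <= n' -> stepn m (eval_conf e' x' K') = ret_conf z 0 ->
    exists z' k, [/\ k < m, Phi Y e' x' z' & stepn k (ret_conf z' K') = ret_conf z 0].
  by move=> mn; apply: IH; rewrite n_def ltnS.
(* A step that changes nothing is absorbed by the induction hypothesis, as one step fewer
   remains. *)
have stuck : stepn n' (eval_conf e x K) = ret_conf y 0 ->
    exists z m, [/\ m < n, Phi Y e x z & stepn m (ret_conf z K) = ret_conf y 0].
  move=> /(IH' _ _ _ _ _ (leqnn _))[z [m [mn ? ?]]]; exists z, m; split=> //.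
  by rewrite n_def ltnW.
case: ifP => [_ //|bad].
rewrite -(pair_eta e) in bad stuck IH' *; move: (lft e) (rgt e) => t d in bad stuck IH' *.
rewrite !pairE in bad stuck *.
have d0 : t < 5 -> d = 0 by move=> t5; move: bad; rewrite t5 /=; case: (d).
case: eqP => [t0|_].
  rewrite t0 d0 ?t0// => E; exists 0, n'; split=> //; first by rewrite n_def.
  exact: Phi_zero.
case: eqP => [t0|_].
  rewrite t0 d0 ?t0// => E; exists x.+1, n'; split=> //; first by rewrite n_def.
  exact: Phi_succ.
case: eqP => [t0|_].
  rewrite t0 d0 ?t0// => E; exists (lft x), n'; split=> //; first by rewrite n_def.
  by rewrite -{1}(pair_eta x); apply: Phi_left.
case: eqP => [t0|_].
  rewrite t0 d0 ?t0// => E; exists (rgt x), n'; split=> //; first by rewrite n_def.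
  by rewrite -{1}(pair_eta x); apply: Phi_right.
case: eqP => [t0|_].
  rewrite t0 d0 ?t0// => E; exists (o x), n'; split=> //; first by rewrite n_def.
  rewrite oY /chi; case: asboolP => ?; first exact: Phi_oracle_in.
  exact: Phi_oracle_out.
case: eqP => [t0|_].
  rewrite t0 -(pair_eta d) !pairE.
  move=> /(IH' _ _ _ _ _ (leqnn _))[z1 [m1 [lt1 P1]]].
  move=> /stepn_ret[m2 def2]; rewrite /ret_step !pairE /=.
  move=> /IH'[|z2 [m3 [lt3 P2]]]; first by lia.
  move=> /stepn_ret[m4 def4]; rewrite /ret_step !pairE /= => E.
  by exists ⟨z1, z2⟩, m4; split=> //; [lia|apply: Phi_pair].
case: eqP => [t0|_].
  rewrite t0 -(pair_eta d) !pairE.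
  move=> /(IH' _ _ _ _ _ (leqnn _))[z1 [m1 [lt1 P1]]].
  move=> /stepn_ret[m2 def2]; rewrite /ret_step !pairE /=.
  move=> /IH'[|z2 [m3 [lt3 P2 E]]]; first by lia.
  by exists z2, m3; split=> //; [lia|apply: Phi_comp P1 P2].
case: eqP => [t0|_].
  rewrite t0 -(pair_eta d) !pairE; case: eqP => [x0|/eqP].
    move=> /(IH' _ _ _ _ _ (leqnn _))[z1 [m1 [lt1 P1 E]]].
    exists z1, m1; split=> //; first by lia.
    by rewrite -(pair_eta x) x0; apply: Phi_prec0.
  case x_def: (rgt x) => [//|k] _ /=.
  move=> /(IH' _ _ _ _ _ (leqnn _))[z1 [m1 [lt1 P1]]].
  move=> /stepn_ret[m2 def2]; rewrite /ret_step !pairE /=.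
  move=> /IH'[|z2 [m3 [lt3 P2 E]]]; first by lia.
  exists z2, m3; split=> //; first by lia.
  by rewrite -(pair_eta x) x_def; apply: Phi_precS P1 P2.
case: eqP => [t0 E|_ //].
rewrite t0.
(* The minimization is generalized to a search that starts at any [k], by induction on the number of
   steps left. *)
suff search m k : m <= n' ->
    stepn m (eval_conf d ⟨x, k⟩ (push ⟨4, ⟨d, ⟨x, k⟩⟩⟩ K)) = ret_conf y 0 ->
    exists r p, [/\ p < m, k <= r,
      forall j, k <= j < r -> exists v, Phi Y d ⟨x, j⟩ v.+1,
      Phi Y d ⟨x, r⟩ 0 & stepn p (ret_conf r K) = ret_conf y 0].
  have [r [p [pn _ below Pr Er]]] := search _ _ (leqnn _) E.
  have /choice[v vP] j : exists v, j < r -> Phi Y d ⟨x, j⟩ v.+1.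
    by case: (ltnP j r) => [/below[v Pv]|]; [exists v|exists 0].
  by exists r, p; split=> //; [lia|apply: Phi_mu vP Pr].
elim/ltn_ind: m k => m IHm k mn /IH'[//|z [m1 [lt1 Pz]]].
move=> /stepn_ret[m2 def2]; rewrite /ret_step !pairE /=.
case: eqP => [z0|/eqP]; last case: z Pz => // z Pz _ E'.
  rewrite z0 in Pz => E'; exists k, m2; split=> //; first by lia.
  by move=> j; rewrite ltnNge andbN.
have /IHm := E'; case; [by lia|by lia|] => r [p [pm kr below Pr Er]].
exists r, p; split=> //; [lia|lia|] => j /andP[]; rewrite leq_eqVlt.
by case/predU1P => [<- _|kj jr]; [exists z|apply: below; rewrite kj].
Qed.

Lemma run_sound e x y s : run o e x s = y.+1 -> Phi Y e x y.
Proof.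
move=> /output_succ /stepn_sound[z [m [_ Pz]]].
rewrite stepn_ret_empty => /(congr1 (fun c => lft (rgt c))).
by rewrite /ret_conf !pairE => <-.
Qed.

End Sound.

End Machine.

Lemma iter_trans (f : nat -> nat) m n c d e :
  iter m f c = d -> iter n f d = e -> iter (m + n) f c = e.
Proof. by move=> cd de; rewrite addnC iterD cd. Qed.

(* Only finitely many oracle queries are made, so an oracle given by
   pointwise convergent approximations is enough. *)
Lemma stepn_complete (o : nat -> nat -> nat) Y e x y :
  (forall q, exists p0, forall p, p0 <= p -> o p q = chi Y q) -> Phi Y e x y ->
  exists p0 n, forall p K, p0 <= p ->
    iter n (step (o p)) (eval_conf e x K) = ret_conf y K.
Proof.
move=> oY.
elim=> {e x y} [x|x|x y|x y|x Yx|x nYx|a b x y z _ [pa [na IHa]] _ [pb [nb IHb]]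
  |a b x y z _ [pb [nb IHb]] _ [pa [na IHa]]|a b x y _ [pa [na IHa]]
  |a b x n y z _ [pa [na IHa]] _ [pb [nb IHb]]|a x y v _ IHv _ [pa [na IHa]]].
- by exists 0, 1 => p K _ /=; rewrite step_eval /eval_step !pairE.
- by exists 0, 1 => p K _ /=; rewrite step_eval /eval_step !pairE.
- by exists 0, 1 => p K _ /=; rewrite step_eval /eval_step !pairE.
- by exists 0, 1 => p K _ /=; rewrite step_eval /eval_step !pairE.
- have [p0 p0P] := oY x; exists p0, 1 => p K /p0P /= ox.
  by rewrite step_eval /eval_step !pairE /= ox /chi asboolT.
- have [p0 p0P] := oY x; exists p0, 1 => p K /p0P /= ox.
  by rewrite step_eval /eval_step !pairE /= ox /chi asboolF.
- exists (maxn pa pb), (1 + (na + (1 + (nb + 1)))) => p K; rewrite geq_max => /andP[ha hb].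
  apply: iter_trans; first by rewrite /= step_eval /eval_step !pairE.
  apply: iter_trans; first exact: IHa.
  apply: iter_trans; first by rewrite /= step_ret_push /ret_step !pairE.
  apply: iter_trans; first exact: IHb.
  by rewrite /= step_ret_push /ret_step !pairE.
- exists (maxn pa pb), (1 + (nb + (1 + na))) => p K; rewrite geq_max => /andP[ha hb].
  apply: iter_trans; first by rewrite /= step_eval /eval_step !pairE.
  apply: iter_trans; first exact: IHb.
  apply: iter_trans; first by rewrite /= step_ret_push /ret_step !pairE.
  exact: IHa.
- exists pa, (1 + na) => p K ha.
  apply: iter_trans; first by rewrite /= step_eval /eval_step !pairE.
  exact: IHa.
- exists (maxn pa pb), (1 + (na + (1 + nb))) => p K; rewrite geq_max => /andP[ha hb].
  apply: iter_trans; first by rewrite /= step_eval /eval_step !pairE.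
  apply: iter_trans; first exact: IHa.
  apply: iter_trans; first by rewrite /= step_ret_push /ret_step !pairE.
  exact: IHb.
(* Here [k] is the distance to the least zero [y], so the induction runs backwards from [y] to the
   start of the search. *)
suff search k : k <= y -> exists p0 n, forall p K, p0 <= p ->
    iter n (step (o p)) (eval_conf a ⟨x, y - k⟩ (push ⟨4, ⟨a, ⟨x, y - k⟩⟩⟩ K))
      = ret_conf y K.
  have [p0 [n nP]] := search y (leqnn y).
  exists p0, (1 + n) => p K hp.
  apply: iter_trans; first by rewrite /= step_eval /eval_step !pairE.
  by have := nP p K hp; rewrite subnn.
elim: k => [_|k IHk ky].
  exists pa, (na + 1) => p K hp; rewrite subn0.
  apply: iter_trans; first exact: IHa.
  by rewrite /= step_ret_push /ret_step !pairE.
have [p1 [n1 h1]] := IHk (ltnW ky).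
have [|p2 [n2 h2]] := IHv (y - k.+1); first by lia.
exists (maxn p1 p2), (n2 + (1 + n1)) => p K; rewrite geq_max => /andP[hp1 hp2].
apply: iter_trans; first exact: h2.
apply: iter_trans; first by rewrite /= step_ret_push /ret_step !pairE.
by rewrite subnSK //; apply: h1.
Qed.

Lemma run_complete (o : nat -> nat -> nat) Y e x y :
  (forall q, exists p0, forall p, p0 <= p -> o p q = chi Y q) -> Phi Y e x y ->
  exists s0, forall p s, s0 <= p -> s0 <= s -> run (o p) e x s = y.+1.
Proof.
move=> oY /(stepn_complete oY)[p0 [n h]].
exists (maxn p0 n) => p s; rewrite !geq_max => /andP[hp _] /andP[_ /run_mono]; apply.
by rewrite /run h// output_ret.
Qed.

Lemma run_chi_complete Y e x y : Phi Y e x y ->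
  exists s0, forall s, s0 <= s -> run (chi Y) e x s = y.+1.
Proof.
move=> /(@run_complete (fun=> chi Y))[|s0 h]; first by exists 0.
by exists s0 => s; apply: h (leqnn s0).
Qed.

(** * Uniqueness of values, change of oracle and an s-m-n theorem *)

(** The machine is deterministic: both values are the output of one sufficiently long run. *)
Lemma Phi_fun X e x y z : Phi X e x y -> Phi X e x z -> y = z.
Proof.
move=> /run_chi_complete[s hs] /run_chi_complete[t ht].
have := hs _ (leq_maxl s t); rewrite ht ?leq_maxr //.
by case.
Qed.

Lemma computable_chi X F : computable_in X F -> computable_in X (fun z => chi X (F z)).
Proof.
apply: (@computable_comp _ (chi X)); exists ⟨4, 0⟩ => x; rewrite /chi.
by case: asboolP; [apply: Phi_oracle_in|apply: Phi_oracle_out].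
Qed.

Lemma computable_run_chi X E Y S :
  computable_in X E -> computable_in X Y -> computable_in X S ->
  computable_in X (fun z => run (chi X) (E z) (Y z) (S z)).
Proof.
move=> Ec Yc Sc.
apply: (@computable_run X (fun=> chi X) (fun=> 0)) => //; last exact: computable_const.
by apply/computable2P/computable_chi; computability.
Qed.

Lemma computable_mu X (h : nat -> nat -> nat) f : computable2_in X h ->
  (forall x, h x (f x) = 0) -> (forall x m, m < f x -> h x m <> 0) ->
  computable_in X f.
Proof.
move=> [a aP] f0 below; exists ⟨8, a⟩ => x.
apply: (@Phi_mu _ _ _ _ (fun m => (h x m).-1)); last by rewrite -(f0 x).
by move=> m /below /eqP; rewrite -lt0n => /prednK ->.
Qed.

(** The same index may behave differently with oracle [X]. Instead, [X] simulates the machine with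
    the empty oracle and searches for a stage at which it has halted. *)
Lemma computable_weaken X f : computable f -> computable_in X f.
Proof.
move=> [e eP].
have ex x : exists s, run (chi set0) e x s == (f x).+1.
  by have [s hs] := run_chi_complete (eP x); exists s; rewrite hs.
have val x s : run (chi set0) e x s != 0 -> run (chi set0) e x s = (f x).+1.
  case E: (run _ _ _ _) => [//|y] _; congr _.+1.
  exact: Phi_fun (run_sound (frefl _) E) (eP x).
have rc : computable2_in X (fun x s => run (chi set0) e x s).
  apply/computable2P; apply: (@computable_run X (fun=> chi set0) (fun=> 0)); computability.
  apply/computable2P; apply: (computable_ext _ (computable_const X 0)) => z.
  by rewrite /chi asboolF.
pose s0 x := ex_minn (ex x).
have sc : computable_in X s0.
  apply: (@computable_mu X (fun x s => run (chi set0) e x s == 0)).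
  - by apply/computable2P; computability.
  - by move=> x; rewrite /s0; case: ex_minnP => s /eqP ->.
  - move=> x m; rewrite /s0; case: ex_minnP => s _ min ms.
    by case: (boolP (run _ _ _ _ == 0)) => // /val/eqP/min; rewrite leqNgt ms.
apply: (@computable_ext _ (fun x => (run (chi set0) e x (s0 x)).-1)); last by computability.
by move=> x; rewrite /s0; case: ex_minnP => s /eqP ->.
Qed.

(** Indices are numbers, so inversion goes through the decoded tag; the three schemes covered are
    those used in [smn_mu]. *)
Lemma Phi_inv X e x y : Phi X e x y ->
  match lft e with
  | 5 => exists y1 y2, [/\ Phi X (lft (rgt e)) x y1, Phi X (rgt (rgt e)) x y2
                         & y = ⟨y1, y2⟩]
  | 6 => exists2 z, Phi X (rgt (rgt e)) x z & Phi X (lft (rgt e)) z y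
  | 8 => Phi X (rgt e) ⟨x, y⟩ 0 /\
         forall m, m < y -> exists v, Phi X (rgt e) ⟨x, m⟩ v.+1
  | _ => True
  end.
Proof.
case=> *; rewrite !pairE //=.
- by do 2 eexists; split; eauto.
- by eexists; eauto.
- by split=> // m my; eexists; eauto.
Qed.

(** The index [F n] composes a minimization with the map from [x] to [⟨n, x⟩]; the constant [n] is
    hardwired as an [n]-fold composition of successors. Building the index takes no oracle, although
    [h] may use [X]. *)
Lemma smn_mu X (h : nat -> nat -> nat -> nat) :
  computable_in X (fun z => h (lft (lft z)) (rgt (lft z)) (rgt z)) ->
  exists2 F : nat -> nat, computable F & forall n x y,
    Phi X (F n) x y <-> h n x y = 0 /\ forall m, m < y -> h n x m <> 0.
Proof.
move=> [a aP].
pose K := primrec ⟨0, 0⟩ (fun _ c => ⟨6, ⟨⟨1, 0⟩, c⟩⟩).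
pose I := ⟨5, ⟨⟨2, 0⟩, ⟨3, 0⟩⟩⟩.
pose F n := ⟨6, ⟨⟨8, a⟩, ⟨5, ⟨K n, I⟩⟩⟩⟩.
have KP n x : Phi X (K n) x n.
  elim: n => [|n IH]; first exact: Phi_zero.
  exact: Phi_comp IH (Phi_succ _ _).
have IP x : Phi X I x x.
  rewrite -(pair_eta x); apply: Phi_pair; [exact: Phi_left|exact: Phi_right].
have haP n x m : Phi X a ⟨⟨n, x⟩, m⟩ (h n x m).
  by have := aP ⟨⟨n, x⟩, m⟩; rewrite !pairE.
exists F => [|n x y].
  have Kc : computable K.
    apply: (@computable_primrec _ (fun=> ⟨0, 0⟩) (fun _ _ c => ⟨6, ⟨⟨1, 0⟩, c⟩⟩));
      by computability.
  by rewrite /computable /F; computability.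
split=> [|[h0 below]].
  move=> /Phi_inv; rewrite !pairE => -[z].
  move=> /Phi_inv; rewrite !pairE => -[y1 [y2 [Py1 Py2 ->]]].
  rewrite (Phi_fun Py1 (KP n x)) (Phi_fun Py2 (IP x)).
  move=> /Phi_inv; rewrite !pairE => -[P0 below]; split.
    exact: Phi_fun (haP n x y) P0.
  by move=> m /below[v Pv]; rewrite (Phi_fun (haP n x m) Pv).
apply: Phi_comp (Phi_pair (KP n x) (IP x)) _.
apply: (@Phi_mu _ _ _ _ (fun m => (h n x m).-1)); last by rewrite -h0.
by move=> m /below /eqP; rewrite -lt0n => /prednK ->.
Qed.

(** * BLR-hard sets are JT-hard *)

Section Cardinal.
Local Open Scope classical_set_scope.
Local Open Scope card_scope.

Lemma card_eq_seq (A : set nat) k : A #= `I_k ->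
  exists s : seq nat, [/\ uniq s, size s = k & forall x, A x <-> x \in s].
Proof.
move=> Ak; have finA : finite_set A by exists k.
exists (finmap.enum_fset (fset_set A)); split; first exact: finmap.fset_uniq.
  exact: card_fset_set.
by move=> x; rewrite (_ : x \in _ = (x \in A)) ?in_setE// -in_fset_set.
Qed.

(** An infinite set would contain a duplicate-free list of more than [M] elements. *)
Lemma card_eq_bounded (A : set nat) M :
  (forall s : seq nat, uniq s -> (forall x, x \in s -> A x) -> size s <= M) ->
  exists2 k, k <= M & A #= `I_k.
Proof.
move=> bnd.
have [/finite_setP[k Ak]|/(@infinite_set_fset _ _ M.+1)[s sA]] := pselect (finite_set A).
  exists k => //; have [s [us <- As]] := card_eq_seq Ak.
  by apply: bnd us _ => x /As.
rewrite leqNgt ltnS bnd ?finmap.fset_uniq// => x xs; exact: sA.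
Qed.

End Cardinal.

Lemma near_infty (P : nat -> Prop) :
  (\forall s \near \oo, P s)%classic <-> exists s0, forall s, s0 <= s -> P s.
Proof. by split=> [[N _ NP]|[N NP]]; exists N. Qed.

Lemma BLR_hard_JT_hard B : BLR_hard B -> JT_hard B.
Proof.
pose j n s := run (chi (jump set0)) n n s.
have /choice[f fP] n : exists y, exists s0, forall s, s0 <= s -> j n s = y.
  have [[s0 j0]|j0] := pselect (exists s, j n s <> 0).
    exists (j n s0), s0 => s; case E: (j n s0) j0 => [//|y] _ ss.
    exact: run_mono ss E.
  by exists 0, 0 => s _; apply: contrapT => js; apply: j0; exists s.
have fBLR : BLR (jump set0) f.
  (* [BLR] asks for strictly fewer changes than the bound, so 2 allows the single change, when the
     run halts. *)
  exists j, (fun=> 2); split=> [||n|n].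
  - by apply/computable2P; apply: computable_run_chi; computability.
  - exact: computable_const.
  - by apply/near_infty.
  apply: card_eq_bounded => -[|x [|y s]] //= /and3P[xs _ _] sj; exfalso.
  have lone s1 s2 : s1 < s2 -> j n s1 <> j n s1.+1 -> j n s2 <> j n s2.+1 -> False.
    move=> s12 j1; apply; case E: (j n s1.+1) => [|z].
      case E': (j n s1) j1 => [|z]; first by rewrite E.
      by rewrite /j (run_mono (leqnSn _) E').
    by rewrite /j !(run_mono _ E) // ltnW.
  have jx : j n x <> j n x.+1 by apply: sj; rewrite mem_head.
  have jy : j n y <> j n y.+1 by apply: sj; rewrite in_cons mem_head orbT.
  case: (ltngtP x y) xs => [xy _|yx _|->]; last by rewrite mem_head.
    exact: lone xy jx jy.
  exact: lone yx jy jx.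
move=> /(_ _ fBLR)[ft [g [ftc gc ftf gP]]].
(* The test is negated because minimization looks for a zero: [F n] converges at [x] when some
   [ft n s] equals [x.+1]. *)
have [|F Fc FP] := @smn_mu B (fun n x s => ~~ (ft n s == x.+1)).
  by computability.
exists F, g; split=> // [n y Jny|n].
  have [s0 s0P] := run_chi_complete Jny; have [s1 s1P] := fP n.
  have fn : f n = y.+1.
    by rewrite -(s1P (maxn s0 s1)) ?leq_maxr// /j s0P ?leq_maxl.
  have /near_infty[s2 s2P] := ftf n.
  have ex : exists s, ft n s == y.+1 by exists s2; rewrite s2P ?fn.
  exists (ex_minn ex); apply/FP; case: ex_minnP => s /eqP -> min; rewrite eqxx; split=> //.
  by move=> m ms; case: eqP => // /eqP/min; rewrite leqNgt ms.
have [k kg /card_eq_seq[c [_ ck cP]]] := gP n.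
apply: card_eq_bounded => s us sW.
(* The elements of the trace lie among the predecessors of [ft n 0] and of the values just after a
   change, at most [k.+1 <= g n] numbers. *)
have /leq_trans : size s <= size (map predn (ft n 0 :: map (fun t => ft n t.+1) c)).
  apply: uniq_leq_size us _ => x /sW[t /FP[]]; case: eqP => // ftx _ _.
  apply/mapP; exists x.+1 => //; rewrite -ftx.
  elim: t {ftx} => [|t IH]; first exact: mem_head.
  have [<- //|/eqP change] := eqVneq (ft n t) (ft n t.+1).
  by rewrite in_cons; apply/orP; right; apply/mapP; exists t => //; apply/cP.
by apply; rewrite size_map /= size_map ck.
Qed.

(** * JT-hard sets are BLR-hard *)

Lemma eventually_all (T : eqType) (s : seq T) (P : T -> nat -> Prop) :
  (forall x, x \in s -> exists N, forall u, N <= u -> P x u) ->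
  exists N, forall x u, x \in s -> N <= u -> P x u.
Proof.
elim: s => [_|y s IH sP]; first by exists 0.
have [x xs|N NP] := IH; first by apply: sP; rewrite in_cons xs orbT.
have [N' N'P] := sP _ (mem_head y s).
exists (maxn N N') => x u; rewrite in_cons geq_max.
by case/predU1P => [->|xs] /andP[Nu N'u]; [apply: N'P|apply: NP].
Qed.

(** At stage [t] the machine for [h] is run for [t] steps on the approximation [o t] of [0'], which
    contains [q] if [Phi_q(q)] halts within [t] steps. A halting computation asks finitely many
    queries, whose answers are eventually right. *)
Lemma limit_lemma h : computable_in (jump set0) h ->
  exists c : nat -> nat -> nat, computable2_in set0 c /\
    forall x, exists t0, forall t, t0 <= t -> c x t = h x.
Proof.
move=> [e eP].
pose o t q := nat_of_bool (run (chi set0) q q t != 0).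
have oc : computable2_in set0 o.
  by apply/computable2P/computable_negb/computable_eq; [apply: computable_run_chi|];
     computability.
have olim q : exists t0, forall t, t0 <= t -> o t q = chi (jump set0) q.
  rewrite /o /chi; case: asboolP => [[y /run_chi_complete[t0 t0P]]|nq].
    by exists t0 => t /t0P ->.
  exists 0 => t _; case E: (run _ _ _ _) => [//|y]; case: nq; exists y.
  exact: (@run_sound _ set0 (frefl _) _ _ _ _ E).
exists (fun x t => (run (o t) e x t).-1); split.
  by apply/computable2P/computable_pred/computable_run; computability.
move=> x; have [t0 t0P] := run_complete olim (eP x).
by exists t0 => t t0t; rewrite t0P.
Qed.

(** * Last nonzero values and numbers of changes of a sequence *)

Lemma lastval_widen V m n : m <= n -> (forall i, m <= i < n -> V i = 0) ->
  lastval V n = lastval V m.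
Proof.
move=> /subnK <-; elim: (n - m) => [//|k IH] V0; rewrite addSn /lastval /=.
rewrite (V0 (k + m)) /=; last by lia.
by apply: IH => i ?; apply: V0; lia.
Qed.

Lemma eq_lastval V V' n : (forall i, i < n -> V i = V' i) ->
  lastval V n = lastval V' n.
Proof.
elim: n => [//|n IH] VV'; rewrite /lastval /= VV' //.
by case: eqP => // _; apply: IH => i /ltnW; apply: VV'.
Qed.

Lemma lastval_last V n i : i < n -> V i != 0 ->
  (forall j, i < j < n -> V j = 0) -> lastval V n = V i.
Proof.
move=> ltin Vi V0; rewrite (lastval_widen ltin V0).
by rewrite /lastval /= (negPf Vi).
Qed.

(** The case [v = 0] is included: then [V] vanishes below [n], and [lastval] has its default
    value. *)
Lemma lastval_unique V n v : (forall i, i < n -> V i = 0 \/ V i = v) ->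
  (exists2 i, i < n & V i = v) -> lastval V n = v.
Proof.
move=> V0v [i]; elim: n V0v => [//|n IH] V0v; rewrite ltnS => ltin Vi.
rewrite /lastval /=; case: eqP => [Vn|]; last by case: (V0v n (ltnSn n)).
move: ltin; rewrite leq_eqVlt => /predU1P[i_n|ltin]; last first.
  by apply: IH => // j /ltnW; apply: V0v.
have v0 : v = 0 by rewrite -Vi i_n.
rewrite v0; apply: (lastval_widen (leq0n n)) => j /andP[_ /ltnW ltjn].
by case: (V0v j ltjn); rewrite ?v0.
Qed.

Lemma eq_sum_leq (T : eqType) (s : seq T) (F G : T -> nat) :
  (forall x, x \in s -> F x <= G x) ->
  \sum_(x <- s) F x = \sum_(x <- s) G x -> forall x, x \in s -> F x = G x.
Proof.
elim: s => [//|y s IH] FG; rewrite !big_cons => E.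
have FGs x : x \in s -> F x <= G x by move=> xs; apply: FG; rewrite in_cons xs orbT.
have ley := FG _ (mem_head y s).
have les : \sum_(x <- s) F x <= \sum_(x <- s) G x.
  by rewrite !(big_nth y) !big_nat leq_sum // => i ?; apply/FGs/mem_nth; lia.
by move=> x; rewrite in_cons => /predU1P[->|]; [lia|apply: IH => //; lia].
Qed.

Definition changes (F : nat -> nat) (s : nat) : nat :=
  \sum_(0 <= j < s) (F j != F j.+1).

Lemma changes_add F s k : changes F s <= changes F (s + k).
Proof. by rewrite /changes (@big_cat_nat _ _ _ s 0 (s + k)) ?leq_addr. Qed.

Lemma leq_changes F s t : s <= t -> changes F s <= changes F t.
Proof. by move=> /subnKC <-; apply: changes_add. Qed.

Lemma changes_eq F s t : s <= t -> changes F s = changes F t -> F s = F t.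
Proof.
move=> /subnKC <-; elim: (t - s) => [|k IH]; first by rewrite addn0.
rewrite addnS {2}/changes big_nat_recr //= -/(changes F _) => E.
have := changes_add F s k; case: eqVneq E => [<- E _|_]; last by lia.
by apply: IH; lia.
Qed.

Lemma eq_changes F G s : (forall j, j <= s -> F j = G j) -> changes F s = changes G s.
Proof.
by move=> FG; rewrite /changes !big_nat; apply: eq_bigr => j /andP[_ js]; rewrite !FG // ltnW.
Qed.

Lemma changes_leq F s k :
  ([set s | F s <> F s.+1] #= `I_k)%card%classic -> changes F s <= k.
Proof.
move=> /card_eq_seq[c [_ <- cP]].
rewrite /changes -big_mkcond /= sum1_count -size_filter.
apply: uniq_leq_size; first by rewrite filter_uniq ?iota_uniq.
by move=> j; rewrite mem_filter => /andP[/eqP Fj _]; apply/cP.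
Qed.

Lemma changes_stationary F s t : s <= t ->
  (forall j, s <= j -> F j = F s) -> changes F t = changes F s.
Proof.
move=> /subnKC <- Fs; elim: (t - s) => [|k IH]; first by rewrite addn0.
rewrite addnS {1}/changes big_nat_recr //= -/(changes F _) IH.
by rewrite !Fs ?eqxx ?addn0 // -?addnS leq_addr.
Qed.

Lemma computable_changes X (H : nat -> nat -> nat) N :
  computable_in X (fun w => H (lft w) (rgt w)) -> computable_in X N ->
  computable_in X (fun z => changes (H z) (N z)).
Proof.
move=> Hc Nc; have H2c : computable2_in X H by apply/computable2P.
by apply: (@computable_sum _ (fun z j => H z j != H z j.+1)) => //; computability.
Qed.

(** * Refutable claims about the changes of a limit, and their trace *)

Section JT_hard_BLR_hard.
Variables (B : set nat) (f g : nat -> nat).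
Hypotheses (fc : computable f) (gc : computable g).
Hypothesis traced : forall k y, J (jump set0) k y -> W B (f k) y.
Hypothesis trace_card :
  forall k, exists2 m, m <= g k & (W B (f k) #= `I_m)%card%classic.
Variables (c : nat -> nat -> nat) (F : nat -> nat -> nat).
Hypothesis cc : computable2_in set0 c.
Hypothesis cF : forall n s, exists t0, forall t, t0 <= t -> c ⟨n, s⟩ t = F n s.

(* [w = ⟨s, t⟩] claims, about [k = ⟨n, i⟩], that [F n] changes [i] times up to
   [s] and that its approximations up to [s] are constant from [t] on; [u]
   bounds the stages at which this is tested. *)
Definition verified (k w u : nat) : bool :=
  (changes (fun j => c ⟨lft k, j⟩ (rgt w)) (lft w) == rgt k) &&
  all (fun j => all (fun t => (t < rgt w) ||
    (c ⟨lft k, j⟩ t == c ⟨lft k, j⟩ (rgt w))) (iota 0 u)) (iota 0 (lft w).+1).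

Lemma verified_anti k w u u' : u <= u' -> verified k w u' -> verified k w u.
Proof.
move=> uu' /andP[ch /allP st]; rewrite /verified ch; apply/allP => j /st /allP stj.
by apply/allP => t tu; apply: stj; rewrite !mem_iota in tu *; lia.
Qed.

(** An approximation that is constant from [rgt w] on already has its limit as value there, so the
    changes counted with [c] are those of [F n]. *)
Lemma verified_forall n i w : (forall u, verified ⟨n, i⟩ w u) ->
  changes (F n) (lft w) = i /\ c ⟨n, lft w⟩ (rgt w) = F n (lft w).
Proof.
move=> ver.
have cw j : j <= lft w -> c ⟨n, j⟩ (rgt w) = F n j.
  move=> jw; have [t0 t0P] := cF n j.
  have /andP[_ /allP/(_ j)] := ver (maxn t0 (rgt w)).+1.
  rewrite mem_iota ltnS jw pairE => /(_ isT)/allP/(_ (maxn t0 (rgt w))).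
  rewrite mem_iota ltnS leqnn ltnNge leq_maxr /= => /(_ isT)/eqP <-.
  by rewrite t0P ?leq_maxl.
split; last exact: cw.
have /andP[/eqP] := ver 0; rewrite !pairE => <- _.
by apply: eq_changes => j jw; rewrite cw.
Qed.

Lemma verified_exists n s :
  exists w, lft w = s /\ forall u, verified ⟨n, changes (F n) s⟩ w u.
Proof.
have [j|t0 t0P] := @eventually_all _ (iota 0 s.+1) (fun j t => c ⟨n, j⟩ t = F n j).
  by move=> _; apply: cF.
exists ⟨s, t0⟩; rewrite pairE; split=> // u; rewrite /verified !pairE; apply/andP; split.
  apply/eqP/eq_changes => j js; apply: t0P => //; by rewrite mem_iota.
apply/allP => j js; apply/allP => t _; case: ltnP => //= t0t.
by rewrite !t0P.
Qed.

Lemma computable_verified X K V U :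
  computable_in X K -> computable_in X V -> computable_in X U ->
  computable_in X (fun z => verified (K z) (V z) (U z) : nat).
Proof.
move=> Kc Vc Uc.
have c2 : computable2_in X c.
  by apply/computable2P/computable_weaken; rewrite /computable; computability.
rewrite /verified; computability.
by apply: (@computable_changes _ (fun z j => c ⟨lft (K z), j⟩ (rgt (V z)))); computability.
Qed.

(* [0'] finds the least permanently verified [w], and this search is traced. *)
Lemma verified_traced : exists2 p, computable p &
  forall n s, exists w, [/\ W B (f (p ⟨n, changes (F n) s⟩)) w &
    forall u, verified ⟨n, changes (F n) s⟩ w u].
Proof.
(* [q ⟨k, w⟩] is the index of a search for a stage that refutes [w], so [0'] decides whether [w] is
   permanently verified. *)
have [|q qc qP] := @smn_mu set0 (fun z _ u => verified (lft z) (rgt z) u).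
  by apply: (@computable_verified _ (fun z => lft (lft (lft z)))); computability.
have chiq k w : chi (jump set0) (q ⟨k, w⟩) = 0 <-> forall u, verified k w u.
  rewrite /chi; split=> [|ver].
    case: asboolP => // nq _ u; apply: contrapT => nv; apply: nq.
    have ex : exists u, ~~ verified k w u by exists u; apply/negP.
    exists (ex_minn ex); apply/qP; rewrite !pairE.
    case: ex_minnP => m /negPf -> min; split=> // l lm.
    case: (boolP (verified _ _ _)) => // /min; by rewrite leqNgt lm.
  by case: asboolP => // -[y /qP[]]; rewrite !pairE ver.
(* This search ignores its input, so its result is the value of [J] at [p k], and [f (p k)] traces
   it. *)
have [|p pc pP] := @smn_mu (jump set0) (fun k _ w => chi (jump set0) (q ⟨k, w⟩)).
  have q' := computable_weaken (jump set0) qc.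
  by apply: computable_chi; computability.
exists p => // n s; set k := ⟨_, _⟩.
have [w0 [_ w0P]] := verified_exists n s.
have ex : exists w, chi (jump set0) (q ⟨k, w⟩) == 0 by exists w0; apply/eqP/chiq.
exists (ex_minn ex); case: ex_minnP => w /eqP w1 min; split; last exact/chiq.
apply: traced; apply/pP; split=> // m mw.
by move=> /eqP/min; rewrite leqNgt mw.
Qed.

(** * The approximation computed from [B] *)

Variable p : nat -> nat.
Hypothesis pc : computable p.

(** With [w < u], a search below [u] meets every number that has appeared by stage [u]. *)
Definition appeared (k w u : nat) : bool :=
  (w < u) && (run (chi B) (f (p k)) w u != 0).

Lemma appeared_mono k w u u' : u <= u' -> appeared k w u -> appeared k w u'.
Proof.
move=> uu' /andP[wu]; rewrite /appeared (leq_trans wu uu').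
by case E: (run _ _ _ _) => [//|y] _; rewrite (run_mono uu' E).
Qed.

Lemma appeared_trace k w u : appeared k w u -> W B (f (p k)) w.
Proof.
by move=> /andP[_]; case E: (run _ _ _ _) => [//|y] _; exists y; apply: (run_sound (frefl _) E).
Qed.

Lemma trace_appeared k w : W B (f (p k)) w ->
  exists N, forall u, N <= u -> appeared k w u.
Proof.
move=> [y /run_chi_complete[s sP]]; exists (maxn s w.+1) => u.
by rewrite geq_max /appeared => /andP[/sP -> ->].
Qed.

(** The suggested value is shifted by one, so that 0 can mean no suggestion. *)
Definition candidate (u k w : nat) : nat :=
  if appeared k w u && verified k w u then (c ⟨lft k, lft w⟩ (rgt w)).+1 else 0.

(** The outer [lastval] selects the largest [i] with a suggestion, the inner one the largest
    suggesting [w]. The predecessor undoes the shift; the default is 0. *)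
Definition approx (b : nat -> nat) (n u : nat) : nat :=
  (lastval (fun i => lastval (candidate u ⟨n, i⟩) u) (b n)).-1.

Lemma computable_approx b : computable b -> computable2_in B (approx b).
Proof.
move=> bc; apply/computable2P.
have bB := computable_weaken B bc; have fB := computable_weaken B fc.
have pB := computable_weaken B pc.
have cB : computable2_in B c.
  by apply/computable2P/computable_weaken; rewrite /computable; computability.
rewrite /approx /candidate /appeared; computability.
all: first [apply: computable_run_chi|apply: computable_verified]; computability.
Qed.

(** The potential [Q] counts the appearances and refutations so far, over all [i < b n] and all
    traced [w]. It never decreases, is at most twice the total size of the traces, and grows
    whenever the approximation changes. *)
Lemma approx_changes b n :
  exists2 m, m <= \sum_(0 <= i < b n) (g (p ⟨n, i⟩) + g (p ⟨n, i⟩)) &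
    ([set u | approx b n u <> approx b n u.+1] #= `I_m)%card%classic.
Proof.
have /choice[S SP] i : exists s, size s <= g (p ⟨n, i⟩) /\
    forall w, W B (f (p ⟨n, i⟩)) w <-> w \in s.
  have [m mg /card_eq_seq[s [_ sm sP]]] := trace_card (p ⟨n, i⟩).
  by exists s; rewrite sm.
(* A candidate contributes once when it appears and once when it is refuted. *)
pose T u i w := appeared ⟨n, i⟩ w u + (appeared ⟨n, i⟩ w u && ~~ verified ⟨n, i⟩ w u).
pose Q u := \sum_(0 <= i < b n) \sum_(w <- S i) T u i w.
have T_mono u i w : T u i w <= T u.+1 i w.
  have := @appeared_mono ⟨n, i⟩ w _ _ (leqnSn u).
  have := @verified_anti ⟨n, i⟩ w _ _ (leqnSn u).
  rewrite /T; case: (appeared _ _ u); case: (appeared _ _ u.+1);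
    case: (verified _ _ u); case: (verified _ _ u.+1) => //= v a;
    by [have := v isT | have := a isT].
have Q_step u : Q u <= Q u.+1 by do 2!apply: leq_sum => ? _.
have Q_mono : {homo Q : u v / u <= v} := homo_leq (@leqnn) leq_trans Q_step.
have Q_bound u : Q u <= \sum_(0 <= i < b n) (g (p ⟨n, i⟩) + g (p ⟨n, i⟩)).
  apply: leq_sum => i _; have [Si _] := SP i.
  apply: (@leq_trans (\sum_(w <- S i) 2)).
    by apply: leq_sum => w _; rewrite /T; do 2!case: (_ ⟨_, _⟩ w u).
  by rewrite big_const_seq count_predT iter_addn_0 mul2n -addnn leq_add.
have Q_lt u : approx b n u <> approx b n u.+1 -> Q u < Q u.+1.
  move=> neq; rewrite ltn_neqAle Q_step andbT; apply/eqP => QE; apply: neq.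
  rewrite /approx; congr _.-1; apply: eq_lastval => i ib.
  have TE w : w \in S i -> T u i w = T u.+1 i w.
    apply: eq_sum_leq => [w' _|]; first exact: T_mono.
    have := @eq_sum_leq _ _ _ _ _ QE; apply; last by rewrite mem_index_iota.
    by move=> i' _; apply: leq_sum => w' _.
  (* The inner search may be extended from [u] to [u.+1]: at stage [u], the number [u] has not
     appeared. *)
  rewrite -[LHS](@lastval_widen _ u u.+1) ?leqnSn //; last first.
    by move=> w uw; rewrite /candidate /appeared ltnNge; case/andP: uw => ->.
  apply: eq_lastval => w _; rewrite /candidate.
  congr (if _ then _ else _).
  (* For a traced [w], equal counts mean that its status is the same at both stages; any other [w]
     never appears. *)
  case wS: (w \in S i).
    move: (TE w wS); rewrite /T.
    have := @appeared_mono ⟨n, i⟩ w _ _ (leqnSn u).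
    case: (appeared _ _ u); case: (appeared _ _ u.+1);
      case: (verified _ _ u); case: (verified _ _ u.+1) => //= a;
      by have := a isT.
  have nap v : appeared ⟨n, i⟩ w v = false.
    by apply/negP => /appeared_trace/(SP i).2; rewrite wS.
  by rewrite !nap.
apply: card_eq_bounded => s us sch.
(* [Q] is injective on the stages of change, and its values there lie strictly below the bound. *)
rewrite -(size_map Q) -[X in _ <= X](size_iota 0); apply: uniq_leq_size.
  rewrite map_inj_in_uniq // => x y /sch /Q_lt Qx /sch /Q_lt Qy Qxy.
  by case: (ltngtP x y) => // /Q_mono; lia.
move=> _ /mapP[x /sch /Q_lt Qx ->]; rewrite mem_iota /=.
exact: leq_trans Qx (Q_bound _).
Qed.

Hypothesis p_traced : forall n s, exists w,
  [/\ W B (f (p ⟨n, changes (F n) s⟩)) w &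
      forall u, verified ⟨n, changes (F n) s⟩ w u].

(** Let [i0] be the final number of changes of [F n]. Once all false claims in the finite traces for
    [i < b n] are refuted, those left for [i0] suggest [y], and none are left for larger [i]. *)
Lemma approx_limit b n s0 y :
  (forall s, s0 <= s -> F n s = y) -> changes (F n) s0 < b n ->
  exists u0, forall u, u0 <= u -> approx b n u = y.
Proof.
move=> Fy i0b; set i0 := changes _ _ in i0b.
(* After [i0] changes the limit is reached, even at a stage before [s0]. *)
have Fw s : changes (F n) s = i0 -> F n s = y.
  case: (leqP s0 s) => [/Fy //|/ltnW ss0 chs].
  by rewrite (changes_eq ss0 chs) Fy.
have chw s : changes (F n) s <= i0.
  case: (leqP s s0) => [/leq_changes -> //|/ltnW s0s].
  by rewrite (changes_stationary s0s) // => j s0j; rewrite !Fy.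
have [w0 [Ww0 w0P]] := p_traced n s0; rewrite -/i0 in Ww0 w0P.
have [u0 u0P] := trace_appeared Ww0.
(* From [N] on, a number that has appeared and is not yet refuted never will be. *)
have [i ib|N NP] := @eventually_all _ (iota 0 (b n)) (fun i u => forall w,
    appeared ⟨n, i⟩ w u && verified ⟨n, i⟩ w u -> forall u', verified ⟨n, i⟩ w u').
  have [m _ /card_eq_seq[S [_ _ SP]]] := trace_card (p ⟨n, i⟩).
  have [w wS|N NP] := @eventually_all _ S (fun w u =>
      verified ⟨n, i⟩ w u -> forall u', verified ⟨n, i⟩ w u').
    have [ver|nver] := pselect (forall u', verified ⟨n, i⟩ w u'); first by exists 0.
    have [u1 nver1] : exists u1, ~ verified ⟨n, i⟩ w u1.
      by apply: contrapT => nex; apply: nver => u'; apply: contrapT => ?; apply: nex; exists u'.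
    by exists u1 => u u1u /(verified_anti u1u).
  by exists N => u Nu w /andP[/appeared_trace/SP wS]; apply: NP.
exists (maxn u0 N) => u; rewrite geq_max => /andP[u0u Nu].
have perm i w : i < b n -> candidate u ⟨n, i⟩ w != 0 ->
    changes (F n) (lft w) = i /\ candidate u ⟨n, i⟩ w = (F n (lft w)).+1.
  move=> ib; rewrite /candidate; case: ifP => // av _.
  have [|ch cw] := @verified_forall n i w; last by rewrite pairE cw.
  by apply: NP _ _ av => //; rewrite mem_iota.
have w0u : w0 < u by have /andP[] := u0P u u0u.
have i0V : lastval (candidate u ⟨n, i0⟩) u = y.+1.
  have val w : candidate u ⟨n, i0⟩ w != 0 -> candidate u ⟨n, i0⟩ w = y.+1.
    by move=> /perm[//|ch ->]; rewrite Fw.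
  apply: lastval_unique => [w _|].
    by case: (eqVneq (candidate u ⟨n, i0⟩ w) 0) => [|/val]; [left|right].
  by exists w0 => //; apply: val; rewrite /candidate u0P // w0P.
rewrite /approx (lastval_last i0b) ?i0V // => i /andP[i0i ib].
(* For [i > i0] an unrefuted pair would give more than [i0] changes, so all candidates are 0; [w0]
   serves merely as a position below [u]. *)
apply: lastval_unique => [w _|].
  left; apply/eqP; apply: contraT => /(perm _ _ ib)[ch _].
  by have := chw (lft w); rewrite ch leqNgt i0i.
exists w0 => //; apply/eqP; apply: contraT => /(perm _ _ ib)[ch _].
by have := chw (lft w0); rewrite ch leqNgt i0i.
Qed.

End JT_hard_BLR_hard.

Lemma JT_hard_BLR_hard B : JT_hard B -> BLR_hard B.
Proof.
move=> [f [g [fc gc traced tcard]]] h [ht [b [htc bc hth bP]]].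
have /computable2P/limit_lemma[c [cc cht]] := htc.
have cF n s : exists t0, forall t, t0 <= t -> c ⟨n, s⟩ t = ht n s.
  by have := cht ⟨n, s⟩; rewrite !pairE.
have [p pc pP] := verified_traced traced cc cF.
(* The successor is there because [BLR] requires the number of changes to be strictly below the
   bound. *)
exists (approx B f c p b), (fun n => (\sum_(0 <= i < b n) (g (p ⟨n, i⟩) + g (p ⟨n, i⟩))).+1).
split=> [||n|n].
- exact: computable_approx.
- apply: computable_succ.
  by apply: (@computable_sum _ (fun n i => g (p ⟨n, i⟩) + g (p ⟨n, i⟩))) => //;
    rewrite /computable in gc pc; computability.
- have /near_infty[s0 s0P] := hth n; have [k kb ch] := bP n.
  apply/near_infty; apply: (approx_limit tcard cF pP s0P).
  exact: leq_ltn_trans (changes_leq s0 ch) kb.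
- have [m mM chm] := approx_changes tcard c p b n.
  by exists m.
Qed.

Theorem corollary2p5 (B : set nat) : JT_hard B <-> BLR_hard B.
Proof. by split; [apply: JT_hard_BLR_hard|apply: BLR_hard_JT_hard]. Qed.
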